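(* Let $\mathcal S\subset\{-1,0,1\}^d$ be a weighted small-step set which is irreducible in the orthant, meaning that for any two lattice points $P,Q\in\mathbb Z_{\ge0}^d$ there is a walk of some length $n\ge1$ from $P$ to $Q$ with all steps in $\mathcal S$ and all points in $\mathbb R_+^d$, with inventory $\chi_{\mathcal S}$, critical point $\boldsymbol{x_0}\in(0,\infty)^d$, covariance matrix $\Delta=(a_{i,j})_{1\le i,j\le d}$ and combinatorial group $G=\langle\varphi_1,\dots,\varphi_d\rangle$ (all defined in the context). Let $J:G\to GL_d(\mathbb R)$, $g\mapsto \mathrm{Jac}_{\boldsymbol{x_0}}\,g$, be the map sending $g$ to its Jacobian matrix at $\boldsymbol{x_0}$. For $h,k\in\mathbb R^d$ set $$[h,k]=\mathrm D^2\chi_{\mathcal S}(\boldsymbol{x_0})(h,k)=\sum_{i,j=1}^d\frac{\partial^2\chi_{\mathcal S}}{\partial x_i\partial x_j}(\boldsymbol{x_0})\,h_ik_j .$$ Let $(e_i)_{1\le i\le d}$ be the canonical basis of $\mathbb R^d$, $\langle\cdot,\cdot\rangle$ the standard scalar product, $u_i=\Delta^{1/2}e_i$ and $f_i=e_i/\sqrt{[e_i,e_i]}$. Then: (i) $J$ is a group morphism. (ii) $[\cdot,\cdot]$ is a scalar product on $\mathbb R^d$. (iii) $[\cdot,\cdot]$ is invariant under $\mathrm{Im}\,J$, i.e. $[J(g)h,J(g)k]=[h,k]$ for all $g\in G$ and $h,k\in\mathbb R^d$. (iv) The linear map $\Phi:\mathbb R^d\to\mathbb R^d$ defined by $\Phi(f_i)=u_i$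 for all $i$ is an isometry from $(\mathbb R^d,[\cdot,\cdot])$ to $(\mathbb R^d,\langle\cdot,\cdot\rangle)$. (v) For all $i$, $S_i=J(\varphi_i)$ is the orthogonal reflection with respect to $e_i$ in $(\mathbb R^d,[\cdot,\cdot])$, i.e. $S_i(e_i)=-e_i$ and $S_i$ is the identity on the $[\cdot,\cdot]$-orthogonal complement of $e_i$.
   Context: Setting. $d\ge1$, $\mathcal S\subset\{-1,0,1\}^d$ is a step set; each $s\in\mathcal S$ carries a weight $w(s)>0$, normalized by $\sum_{s\in\mathcal S}w(s)=1$. For $P,Q\in\mathbb Z_{\ge0}^d$, $e_C(P,Q;n)$ denotes the weighted number of walks of length $n$ from $P$ to $Q$ with steps in $\mathcal S$ and all points in the orthant $C=\mathbb R_+^d$. Irreducibility: for any two lattice points $P,Q\in\mathbb Z_{\ge 0}^d$ there is $n\ge1$ with $e_C(P,Q;n)\neq0$. Inventory: $\chi_{\mathcal S}(x_1,\dots,x_d)=\sum_{s\in\mathcal S}w(s)x_1^{s_1}\cdots x_d^{s_d}$. Under irreducibility (known fact) the system $\partial\chi_{\mathcal S}/\partial x_1=\dots=\partial\chi_{\mathcal S}/\partial x_d=0$ has a unique solution $\boldsymbol{x_0}$ in $(0,\infty)^d$, which is the minimum of $\chi_{\mathcal S}$ on $(0,\infty)^d$. Covariance matrix: $\Delta=(a_{i,j})$ with $a_{i,j}=\dfrac{\partial_{x_i}\partial_{x_j}\chi_{\mathcal S}(\boldsymbol{x_0})}{\sqrt{\partial_{x_i}^2\chi_{\mathcal S}(\boldsymbol{x_0})\,\partial_{x_j}^2\chi_{\mathcal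 S}(\boldsymbol{x_0})}}$. It is symmetric positive definite with unit diagonal; $\Delta^{1/2}$ is its symmetric positive definite square root. Group $G$: for each $i$ write $\chi_{\mathcal S}=x_iA_i+B_i+x_i^{-1}C_i$ with $A_i,B_i,C_i$ Laurent polynomials not depending on $x_i$. Let $\varphi_i$ be the birational involution replacing the $i$-th coordinate $x_i$ by $\frac{1}{x_i}\frac{C_i}{A_i}$ and fixing the other coordinates. $G=\langle\varphi_1,\dots,\varphi_d\rangle$ is the group of birational transformations they generate. Every $g\in G$ is regular at $\boldsymbol{x_0}$ and fixes $\boldsymbol{x_0}$, so its Jacobian there makes sense. *)

(* Defs.v *)
From HB Require Import structures.
From mathcomp Require Import all_boot all_order all_algebra finmap.
From mathcomp Require Import all_classical all_reals all_analysis.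
From mathcomp Require Import fraction.
(* The notations of mpoly clash with those of MathComp-Analysis. *)
From mathcomp Require Import -(notations) mpoly.

Set Implicit Arguments.
Unset Strict Implicit.
Unset Printing Implicit Defensive.

Import Order.TTheory GRing.Theory Num.Theory numFieldNormedType.Exports.

Local Open Scope fset_scope.
Local Open Scope ring_scope.

Notation "p %:F" := (@tofrac _ p).

Notation lattice d := {ffun 'I_d -> int}.

Definition small_steps (d : nat) (S : {fset lattice d}) : Prop :=
  forall s : lattice d, s \in S -> forall i, s i \in [:: -1; 0; 1].

Definition weighting (R : realType) (d : nat) (S : {fset lattice d})
    (w : lattice d -> R) : Prop :=
  (forall s, s \in S -> 0 < w s) /\ \sum_(s <- S) w s = 1.

Definition orthant (d : nat) : pred (lattice d) :=
  fun P => [forall i, 0 <= P i].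

Definition walk_edge (d : nat) (S : {fset lattice d}) : rel (lattice d) :=
  fun P Q => (Q - P \in S) && orthant Q.

(* The list p holds the points visited after P, so its size is the length of
   the walk. *)
Definition irreducible (d : nat) (S : {fset lattice d}) : Prop :=
  forall P Q : lattice d, orthant P -> orthant Q ->
  exists p : seq (lattice d),
    [/\ (1 <= size p)%N, path (walk_edge S) P p & last P p = Q].

(* The inventory at a point x of F^d, the weights being sent to F by iota.  It
   is used with F = R, and with F the field of rational functions and x the
   tuple of variables. *)
Definition inventory (R : realType) (d : nat) (S : {fset lattice d})
    (w : lattice d -> R) (F : fieldType) (iota : R -> F) (x : 'I_d -> F) : F :=
  \sum_(s <- S) iota (w s) * \prod_(i < d) x i ^ s i.

Definition chi (R : realType) (d : nat) (S : {fset lattice d})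
    (w : lattice d -> R) (x : 'cV[R]_d) : R :=
  inventory S w idfun (fun i => x i 0).

Definition basis_vec (R : realType) (d : nat) (i : 'I_d) : 'cV[R]_d :=
  delta_mx i 0.

Definition partial (R : realType) (d : nat) (i : 'I_d) (f : 'cV[R]_d -> R)
    (x : 'cV[R]_d) : R :=
  'D_(basis_vec R i) f x.

Definition critical_point (R : realType) (d : nat) (S : {fset lattice d})
    (w : lattice d -> R) (x : 'cV[R]_d) : Prop :=
  (forall i, 0 < x i 0) /\ (forall i, partial i (chi S w) x = 0).

Definition hess (R : realType) (d : nat) (S : {fset lattice d})
    (w : lattice d -> R) (x0 : 'cV[R]_d) (i j : 'I_d) : R :=
  partial i (partial j (chi S w)) x0.

Definition cov_matrix (R : realType) (d : nat) (S : {fset lattice d})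
    (w : lattice d -> R) (x0 : 'cV[R]_d) : 'M[R]_d :=
  \matrix_(i, j)
    (hess S w x0 i j / Num.sqrt (hess S w x0 i i * hess S w x0 j j)).

Definition hess_form (R : realType) (d : nat) (S : {fset lattice d})
    (w : lattice d -> R) (x0 h k : 'cV[R]_d) : R :=
  \sum_(i < d) \sum_(j < d) hess S w x0 i j * h i 0 * k j 0.

Definition dot (R : realType) (d : nat) (h k : 'cV[R]_d) : R :=
  \sum_(i < d) h i 0 * k i 0.

Definition spd (R : realType) (d : nat) (M : 'M[R]_d) : Prop :=
  M^T = M /\ forall v : 'cV[R]_d, v != 0 -> 0 < dot v (M *m v).

Definition spd_sqrt (R : realType) (d : nat) (M B : 'M[R]_d) : Prop :=
  spd B /\ B *m B = M.

Definition scalar_product (R : realType) (d : nat)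
    (b : 'cV[R]_d -> 'cV[R]_d -> R) : Prop :=
  [/\ forall h k, b h k = b k h,
      forall (a : R) h h' k, b (a *: h + h') k = a * b h k + b h' k &
      forall h, h != 0 -> 0 < b h h].

Definition isometry_between (R : realType) (d : nat)
    (b b' : 'cV[R]_d -> 'cV[R]_d -> R) (Phi : 'cV[R]_d -> 'cV[R]_d) : Prop :=
  bijective Phi /\ forall h k, b' (Phi h) (Phi k) = b h k.

Definition orthogonal_reflection (R : realType) (d : nat)
    (b : 'cV[R]_d -> 'cV[R]_d -> R) (e : 'cV[R]_d) (S : 'cV[R]_d -> 'cV[R]_d)
    : Prop :=
  S e = - e /\ forall h, b h e = 0 -> S h = h.

Notation ratfun R d := {fraction (mpoly d R)}.

Definition ratconst (R : realType) (d : nat) (c : R) : ratfun R d :=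
  (mpolyC d c)%:F.

Definition ratvar (R : realType) (d : nat) (i : 'I_d) : ratfun R d :=
  (mpolyX R (mnm1 i))%:F.

(* f can be evaluated at a in F^d when it has some representative p / q whose
   denominator does not vanish at a; p and q are not required to be coprime. *)
Definition ratfun_regular (R : realType) (d : nat) (F : fieldType) (iota : R -> F)
    (a : 'I_d -> F) (f : ratfun R d) : Prop :=
  exists p q : mpoly d R, f = p%:F / q%:F /\ mmap iota a q != 0.

(* The value at a of f, by convention 0 when f is not regular at a.  With
   F = R this is the function defined by f; with F the field of rational
   functions it is the substitution of a for the variables of f. *)
Definition ratval (R : realType) (d : nat) (F : fieldType) (iota : R -> F)
    (a : 'I_d -> F) (f : ratfun R d) : F :=
  xget 0 [set v | exists p q : mpoly d R,
    [/\ f = p%:F / q%:F, mmap iota a q != 0 & v = mmap iota a p / mmap iota a q]].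

Lemma ratvalE (R : realType) (d : nat) (F : fieldType) (iota : {rmorphism R -> F})
    (a : 'I_d -> F) (p q : mpoly d R) :
  mmap iota a q != 0 ->
  ratval iota a (p%:F / q%:F) = mmap iota a p / mmap iota a q.
Proof.
move=> q0; rewrite /ratval; case: xgetP => [v _ [p' [q' [e q'0 ->]]]|]; last first.
  by move=> /(_ (mmap iota a p / mmap iota a q)) []; exists p, q.
have nz r : mmap iota a r != 0 -> r%:F != 0 :> ratfun R d.
  by rewrite tofrac_eq0; apply: contraNneq => ->; rewrite mmap0.
have /eqP := e; rewrite eqr_div ?nz// -!tofracM tofrac_eq => /eqP {}e.
by apply/eqP; rewrite eqr_div// -!rmorphM e.
Qed.

(* Rational self-maps of R^d, as d-tuples of rational functions; {ffun _} makes
   equality componentwise. *)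
Notation ratmap R d := {ffun 'I_d -> ratfun R d}.

Definition ratmap_id (R : realType) (d : nat) : ratmap R d :=
  [ffun i => ratvar R i].

(* g o h.  A component where the substitution is undefined is 0. *)
Definition ratmap_comp (R : realType) (d : nat) (g h : ratmap R d)
    : ratmap R d :=
  [ffun i => ratval (@ratconst R d) h (g i)].

(* The components of ratmap_id are nonzero, so these equations force all the
   substitutions involved to be defined. *)
Definition ratmap_inverse (R : realType) (d : nat) (g h : ratmap R d) : Prop :=
  ratmap_comp g h = ratmap_id R d /\ ratmap_comp h g = ratmap_id R d.

Definition birational (R : realType) (d : nat) (g : ratmap R d) : Prop :=
  exists h, ratmap_inverse g h.

(* The coefficient of x_i ^ e in the inventory: A_i, B_i, C_i are the values
   e = 1, 0, -1. *)
Definition inventory_coef (R : realType) (d : nat) (S : {fset lattice d})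
    (w : lattice d -> R) (i : 'I_d) (e : int) : ratfun R d :=
  \sum_(s <- S | s i == e)
    ratconst d (w s) * \prod_(j < d | j != i) ratvar R j ^ s j.

Lemma inventory_decomp (R : realType) (d : nat) (S : {fset lattice d})
    (w : lattice d -> R) (i : 'I_d) :
  small_steps S ->
  inventory S w (@ratconst R d) (@ratvar R d) =
    ratvar R i * inventory_coef S w i 1 + inventory_coef S w i 0
    + (ratvar R i)^-1 * inventory_coef S w i (-1).
Proof.
move=> smallS; rewrite /inventory /inventory_coef !mulr_sumr.
rewrite [X in X + _ + _]big_mkcond [X in _ + X + _]big_mkcond.
rewrite [X in _ + _ + X]big_mkcond -!big_split /= !big_seq.
apply: eq_bigr => s sS; rewrite (bigD1 i)//=.
have := smallS s sS i; rewrite !inE => /or3P[] /eqP ->.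
- by rewrite !add0r exprN1 mulrCA.
- by rewrite add0r addr0 expr0z mul1r.
- by rewrite !addr0 expr1z mulrCA.
Qed.

Definition phi (R : realType) (d : nat) (S : {fset lattice d})
    (w : lattice d -> R) (i : 'I_d) : ratmap R d :=
  [ffun j => if j == i
             then (ratvar R i)^-1 *
                  (inventory_coef S w i (-1) / inventory_coef S w i 1)
             else ratvar R j].

Inductive combi_group (R : realType) (d : nat) (S : {fset lattice d})
    (w : lattice d -> R) : ratmap R d -> Prop :=
| combi_group_gen i : combi_group S w (phi S w i)
| combi_group_id : combi_group S w (ratmap_id R d)
| combi_group_comp g h :
    combi_group S w g -> combi_group S w h -> combi_group S w (ratmap_comp g h)
| combi_group_inv g h :
    combi_group S w g -> ratmap_inverse g h -> combi_group S w h.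

Definition regular_at (R : realType) (d : nat) (g : ratmap R d)
    (x : 'cV[R]_d) : Prop :=
  forall i, ratfun_regular idfun (fun j => x j 0) (g i).

Definition ratfun_eval (R : realType) (d : nat) (f : ratfun R d)
    (x : 'cV[R]_d) : R :=
  ratval idfun (fun j => x j 0) f.

Definition ratmap_eval (R : realType) (d : nat) (g : ratmap R d)
    (x : 'cV[R]_d) : 'cV[R]_d :=
  \col_i ratfun_eval (g i) x.

(* Acts on column vectors; the Jacobian of MathComp-Analysis is the transpose,
   acting on row vectors. *)
Definition Jac (R : realType) (d : nat) (x : 'cV[R]_d) (g : ratmap R d)
    : 'M[R]_d :=
  \matrix_(i, j) partial j (ratfun_eval (g i)) x.

(* Main.v *)
Require Import Defs.
From mathcomp Require Import all_boot all_order all_algebra finmap.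
From mathcomp Require Import all_classical all_reals all_analysis.
From mathcomp Require Import fraction.
From mathcomp Require Import -(notations) mpoly.
Import Order.TTheory GRing.Theory Num.Theory numFieldNormedType.Exports.
From mathcomp Require Import ring.
From mathcomp Require Import generic_quotient.
From HB Require Import structures.

Set Implicit Arguments.
Unset Strict Implicit.
Unset Printing Implicit Defensive.

Local Open Scope ring_scope.

(* Call f = p / q regular at a, with value p(a) / q(a), when q(a) <> 0.  Values
   are compatible with the field operations and with substitution, both for a
   real point and for a tuple of rational functions; this gives the partial
   associativity of composition, hence the uniqueness of inverses, and lets every
   element of G carry an inverse that is also regular at x0.  The chain rule
   turns J into a morphism, so invariance of the form has to be checked on the
   generators only.  At a critical point,
     x_i x_j (d_i d_j chi) = sum_s w(s) s_i s_j x^s,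
   so [h, h] is a weighted sum of the squares of the sum_i s_i h_i / x_i, which
   is definite because an irreducible step set spans R^d.
   Criticality also gives C_i = x_i^2 A_i and A_i = x_i H_ii / 2 at x0, where H is
   the Hessian, whence J(phi_i) h = h - 2 [h, e_i] / [e_i, e_i] e_i. *)

(** * Values of rational functions *)

Lemma fraction_numden (D : idomainType) (f : {fraction D}) :
  exists p q : D, q != 0 /\ f = p%:F / q%:F.
Proof.
elim/quotW: f => x; exists (frac x).1, (frac x).2.
have d0 := denom_ratioP x; split => //.
(* Clearing the denominator leaves an equality between classes of ratios, decided by
   cross-multiplication. *)
apply: (@mulIf _ (frac x).2%:F); first by rewrite tofrac_eq0.
rewrite divfK ?tofrac_eq0// [LHS]/GRing.mul/= !piE; apply/eqP; rewrite piE.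
by rewrite FracField.equivfE !numden_Ratio ?mulr1 ?mulf_neq0 ?oner_neq0// mulrC.
Qed.

(** As [ratconst] is a ring morphism, the results on values also apply over the field of rational
    functions, where evaluation is substitution. *)
HB.instance Definition _ (R : realType) (d : nat) :=
  GRing.RMorphism.copy (@ratconst R d)
    (@tofrac (mpoly d R) \o @mpolyC d R).

Section Valuation.
Variables (R : realType) (d : nat).

(* The graph of evaluation at a, on the local ring of the rational functions
   regular at a. *)
Definition has_val (F : fieldType) (iota : R -> F) (a : 'I_d -> F)
    (f : ratfun R d) (v : F) : Prop :=
  exists p q : mpoly d R,
    [/\ f = p%:F / q%:F, mmap iota a q != 0 & v = mmap iota a p / mmap iota a q].

Section Field.
Variables (F : fieldType) (iota : {rmorphism R -> F}) (a : 'I_d -> F).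
Implicit Types (f g : ratfun R d) (u v : F).

Lemma has_val_ratval f v : has_val iota a f v -> ratval iota a f = v.
Proof. by case=> p [q [-> q0 ->]]; rewrite ratvalE. Qed.

Lemma has_val_inj f u v : has_val iota a f u -> has_val iota a f v -> u = v.
Proof. by move=> /has_val_ratval <- /has_val_ratval <-. Qed.

Lemma has_val_regular f v : has_val iota a f v -> ratfun_regular iota a f.
Proof. by case=> p [q [-> q0 _]]; exists p, q. Qed.

Lemma regular_has_val f :
  ratfun_regular iota a f -> has_val iota a f (ratval iota a f).
Proof. by case=> p [q [-> q0]]; exists p, q; split; rewrite // ratvalE. Qed.

(** The default value of [ratval] is 0, so a nonzero value comes from an actual representative. *)
Lemma ratval_neq0_regular f : ratval iota a f != 0 -> ratfun_regular iota a f.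
Proof.
rewrite /ratval; case: xgetP => [v _ [p [q [-> q0 _]]] _|]; last by rewrite eqxx.
by exists p, q.
Qed.

Lemma tofrac_neq0_of_mmap (q : mpoly d R) :
  mmap iota a q != 0 -> q%:F != 0 :> ratfun R d.
Proof. by rewrite tofrac_eq0; apply: contraNneq => ->; rewrite mmap0. Qed.

Lemma has_val_poly (p : mpoly d R) : has_val iota a p%:F (mmap iota a p).
Proof.
by exists p, 1; rewrite tofrac1 invr1 mulr1 rmorph1 invr1 mulr1 oner_neq0.
Qed.

Lemma has_val_const c : has_val iota a (ratconst d c) (iota c).
Proof. by have := has_val_poly (mpolyC d c); rewrite mmapC. Qed.

Lemma has_val_var i : has_val iota a (ratvar R i) (a i).
Proof.
by have := has_val_poly (mpolyX R (mnm1 i)); rewrite mmapX mmap1U.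
Qed.

Lemma has_valD f g u v :
  has_val iota a f u -> has_val iota a g v -> has_val iota a (f + g) (u + v).
Proof.
move=> [p [q [-> q0 ->]]] [p' [q' [-> q'0 ->]]].
exists (p * q' + p' * q), (q * q').
by rewrite !rmorphM mulf_neq0 ?addf_div ?tofrac_neq0_of_mmap// !rmorphD !rmorphM.
Qed.

Lemma has_valM f g u v :
  has_val iota a f u -> has_val iota a g v -> has_val iota a (f * g) (u * v).
Proof.
move=> [p [q [-> q0 ->]]] [p' [q' [-> q'0 ->]]]; exists (p * p'), (q * q').
by rewrite !rmorphM mulf_neq0 // !mulf_div.
Qed.

Lemma has_valV f v : v != 0 -> has_val iota a f v -> has_val iota a f^-1 v^-1.
Proof.
move=> v0 [p [q [-> q0 vE]]]; exists q, p; move: v0; rewrite vE !invf_div.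
by rewrite mulf_eq0 => /norP[? _].
Qed.

Lemma has_val0 : has_val iota a 0 0.
Proof. by have := has_val_poly 0; rewrite tofrac0 mmap0. Qed.

Lemma has_val1 : has_val iota a 1 1.
Proof. by have := has_val_poly 1; rewrite tofrac1 rmorph1. Qed.

Lemma has_val_neq0 f v : v != 0 -> has_val iota a f v -> f != 0.
Proof.
move=> v0 fv; apply: contra_neq v0 => f0; rewrite f0 in fv.
exact: has_val_inj fv has_val0.
Qed.

Lemma has_valX f v n : has_val iota a f v -> has_val iota a (f ^+ n) (v ^+ n).
Proof.
move=> fv; elim: n => [|n IHn]; first by rewrite !expr0; exact: has_val1.
by rewrite !exprS; exact: has_valM.
Qed.

Lemma has_valXz f v (z : int) :
  v != 0 -> has_val iota a f v -> has_val iota a (f ^ z) (v ^ z).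
Proof.
move=> v0 fv; case: z => n; first exact: has_valX.
by apply: has_valV; [rewrite expf_neq0 | exact: has_valX].
Qed.

Lemma has_val_sum (I : Type) (r : seq I) (P : pred I) (f : I -> ratfun R d)
    (v : I -> F) :
  (forall i, P i -> has_val iota a (f i) (v i)) ->
  has_val iota a (\sum_(i <- r | P i) f i) (\sum_(i <- r | P i) v i).
Proof.
move=> fv; apply: (big_ind2 (has_val iota a)) => [|f1 v1 f2 v2|].
- exact: has_val0.
- exact: has_valD.
- exact: fv.
Qed.

Lemma has_val_prod (I : Type) (r : seq I) (P : pred I) (f : I -> ratfun R d)
    (v : I -> F) :
  (forall i, P i -> has_val iota a (f i) (v i)) ->
  has_val iota a (\prod_(i <- r | P i) f i) (\prod_(i <- r | P i) v i).
Proof.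
move=> fv; apply: (big_ind2 (has_val iota a)) => [|f1 v1 f2 v2|].
- exact: has_val1.
- exact: has_valM.
- exact: fv.
Qed.

Lemma has_val_mmap (g : 'I_d -> ratfun R d) (b : 'I_d -> F) (r : mpoly d R) :
  (forall i, has_val iota a (g i) (b i)) ->
  has_val iota a (mmap (@ratconst R d) g r) (mmap iota b r).
Proof.
move=> gb; apply: has_val_sum => m _; apply: has_valM; first exact: has_val_const.
by apply: has_val_prod => i _; exact: has_valX.
Qed.

(** The denominator q(g) takes the value q(b) at [a], which is nonzero; hence q(g) is a nonzero
    rational function and the substitution is defined. *)
Lemma has_val_subst (g : 'I_d -> ratfun R d) (b : 'I_d -> F) f v :
  (forall i, has_val iota a (g i) (b i)) -> has_val iota b f v ->
  has_val iota a (ratval (@ratconst R d) g f) v.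
Proof.
move=> gb [p [q [-> q0 ->]]].
rewrite ratvalE; last exact: has_val_neq0 q0 (has_val_mmap q gb).
by apply: has_valM; [|apply: has_valV => //]; exact: has_val_mmap.
Qed.

End Field.

(** * Composition and inverses of rational maps *)

Implicit Types g h : ratmap R d.

Lemma mmap_ratvar (r : mpoly d R) : mmap (@ratconst R d) (@ratvar R d) r = r%:F.
Proof.
rewrite [in RHS](mpolyE r) rmorph_sum; apply: eq_bigr => m _.
rewrite -mul_mpolyC rmorphM; congr (_ * _).
rewrite mpolyXE_id rmorph_prod; apply: eq_bigr => i _.
by rewrite rmorphXn.
Qed.

Lemma has_val_ratvar f : has_val (@ratconst R d) (@ratvar R d) f f.
Proof.
have [p [q [q0 ->]]] := fraction_numden f; exists p, q.
by rewrite !mmap_ratvar tofrac_eq0.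
Qed.

Lemma ratmap_idE : (ratmap_id R d : 'I_d -> ratfun R d) = @ratvar R d.
Proof. by apply/funext => i; rewrite ffunE. Qed.

Lemma ratmap_compE g h i :
  ratmap_comp g h i = ratval (@ratconst R d) h (g i).
Proof. by rewrite ffunE. Qed.

Lemma ratmap_comp_id g : ratmap_comp g (ratmap_id R d) = g.
Proof.
apply/ffunP => i; rewrite ffunE.
rewrite ratmap_idE; exact: has_val_ratval (has_val_ratvar _).
Qed.

Lemma ratmap_id_comp g : ratmap_comp (ratmap_id R d) g = g.
Proof.
apply/ffunP => i; rewrite !ffunE.
exact: has_val_ratval (has_val_var _ _ _).
Qed.

(** Excludes the default value 0 from the components of [ratmap_comp g h]. *)
Definition composable g h : Prop :=
  forall i, ratfun_regular (@ratconst R d) h (g i).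

Lemma composable_has_val g h : composable g h ->
  forall i, has_val (@ratconst R d) h (g i) (ratmap_comp g h i).
Proof. by move=> gh i; rewrite ratmap_compE; exact: regular_has_val. Qed.

(** At [h], each g_i takes the value (g o h)_i, so by substitution f(g) takes the value f(g o h). *)
Lemma ratmap_compA f g h : composable g h -> composable f (ratmap_comp g h) ->
  ratmap_comp (ratmap_comp f g) h = ratmap_comp f (ratmap_comp g h).
Proof.
move=> gh fgh; apply/ffunP => i.
rewrite [LHS]ratmap_compE [RHS]ratmap_compE (ratmap_compE f).
apply: has_val_ratval; apply: has_val_subst (composable_has_val gh) _.
exact: regular_has_val.
Qed.

Lemma ratvar_neq0 i : ratvar R i != 0 :> ratfun R d.
Proof. by rewrite tofrac_eq0 -msize_poly_eq0 msizeX. Qed.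

Lemma comp_id_composable g h : ratmap_comp g h = ratmap_id R d -> composable g h.
Proof.
move=> gh i; apply: ratval_neq0_regular.
by move/ffunP/(_ i): gh; rewrite !ffunE => ->; exact: ratvar_neq0.
Qed.

Lemma composable_id g : composable g (ratmap_id R d).
Proof.
move=> i; rewrite ratmap_idE; exact: has_val_regular (has_val_ratvar _).
Qed.

(** Equivalently, no nonzero polynomial vanishes at [g]: its components are algebraically
    independent. *)
Definition dominant g : Prop := forall f, ratfun_regular (@ratconst R d) g f.

(** The inverse of [f] has a value at [g] too, and the product of both values is 1. *)
Lemma dominant_val_neq0 g f v :
  dominant g -> f != 0 -> has_val (@ratconst R d) g f v -> v != 0.
Proof.
move=> gdom f0 fv; have fV := regular_has_val (gdom f^-1).
have ff : has_val (@ratconst R d) g 1 (v * ratval (@ratconst R d) g f^-1).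
  by rewrite -[X in has_val _ _ X](mulfV f0); exact: has_valM.
apply: contra_eq_neq (has_val_inj ff (has_val1 _ _)) => ->.
by rewrite mul0r eq_sym oner_neq0.
Qed.

(** If q is nonzero, so is q(g), and then so is q(g)(h) = q(g o h). *)
Lemma dominant_comp g h : dominant g -> dominant h -> dominant (ratmap_comp g h).
Proof.
move=> gdom hdom f; have [p [q [q0 ->]]] := fraction_numden f.
exists p, q; split => //.
have qh := has_val_mmap q (composable_has_val (fun i => hdom (g i))).
apply: dominant_val_neq0 hdom _ qh.
by apply: dominant_val_neq0 gdom _ (has_val_poly _ _ q); rewrite tofrac_eq0.
Qed.

(* Substituting h in q(g) = 0 gives q = 0. *)
Lemma right_inverse_dominant g h :
  ratmap_comp g h = ratmap_id R d -> dominant g.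
Proof.
move=> gh f; have [p [q [q0 ->]]] := fraction_numden f; exists p, q; split => //.
have gv := composable_has_val (comp_id_composable gh).
apply: (has_val_neq0 _ (has_val_mmap q gv)); rewrite gh ratmap_idE.
by rewrite mmap_ratvar tofrac_eq0.
Qed.

Lemma ratmap_inverse_sym g h : ratmap_inverse g h -> ratmap_inverse h g.
Proof. by case. Qed.

(** The usual h = h(gh') = (hg)h' = h'; reassociation is licit because gh' is the identity. *)
Lemma ratmap_inverse_uniq g h h' :
  ratmap_inverse g h -> ratmap_inverse g h' -> h = h'.
Proof.
move=> [gh hg] [gh' h'g].
rewrite -[LHS]ratmap_comp_id -gh' -ratmap_compA.
- by rewrite hg ratmap_id_comp.
- exact: comp_id_composable.
- by rewrite gh'; exact: composable_id.
Qed.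

(** The product collapses from the inside. All reassociations are licit because maps with a right
    inverse are dominant. *)
Lemma ratmap_inverse_comp g g' h h' : ratmap_inverse g g' -> ratmap_inverse h h' ->
  ratmap_inverse (ratmap_comp g h) (ratmap_comp h' g').
Proof.
(* One of the two identities; the other is the same statement with each map exchanged for its
   inverse. *)
have half g1 g2 h1 h2 : ratmap_inverse g1 g2 -> ratmap_inverse h1 h2 ->
    ratmap_comp (ratmap_comp g1 h1) (ratmap_comp h2 g2) = ratmap_id R d.
  move=> [g12 g21] [h12 h21].
  have dg := right_inverse_dominant g21.
  have dh := right_inverse_dominant h21.
  have dhg := dominant_comp dh dg.
  have hgg : ratmap_comp h1 (ratmap_comp h2 g2) = g2.
    transitivity (ratmap_comp (ratmap_comp h1 h2) g2).
      by symmetry; apply: ratmap_compA => i; [exact: dg | exact: dhg].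
    by rewrite h12; exact: ratmap_id_comp.
  transitivity (ratmap_comp g1 (ratmap_comp h1 (ratmap_comp h2 g2))).
    by apply: ratmap_compA => i; [exact: dhg | rewrite hgg; exact: dg].
  by rewrite hgg.
move=> gg hh; split; first exact: half gg hh.
exact: half (ratmap_inverse_sym hh) (ratmap_inverse_sym gg).
Qed.

End Valuation.

(** * Differentiation of monomials *)

Section Calculus.
Variable R : realType.

Section NormedModule.
Variable V : normedModType R.
Implicit Types (x v : V) (I : Type).

Lemma differentiable_big_sum I (r : seq I) (F : I -> V -> R) x :
  (forall i, differentiable (F i) x) ->
  differentiable (fun y => \sum_(i <- r) F i y) x.
Proof.
move=> dF; elim: r => [|i r IHr].
  under [X in differentiable X _]eq_fun do rewrite big_nil.
  exact: differentiable_cst.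
under [X in differentiable X _]eq_fun do rewrite big_cons.
exact: differentiableD.
Qed.

Lemma differentiable_big_prod I (r : seq I) (F : I -> V -> R) x :
  (forall i, differentiable (F i) x) ->
  differentiable (fun y => \prod_(i <- r) F i y) x.
Proof.
move=> dF; elim: r => [|i r IHr].
  under [X in differentiable X _]eq_fun do rewrite big_nil.
  exact: differentiable_cst.
under [X in differentiable X _]eq_fun do rewrite big_cons.
exact: differentiableM.
Qed.

Lemma is_derive_big_sum I (r : seq I) (P : pred I) (F : I -> V -> R)
    (dF : I -> R) x v :
  (forall i, is_derive x v (F i) (dF i)) ->
  is_derive x v (fun y => \sum_(i <- r | P i) F i y) (\sum_(i <- r | P i) dF i).
Proof.
move=> hF; elim: r => [|i r IHr].
  under [X in is_derive _ _ X]eq_fun do rewrite big_nil.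
  by rewrite big_nil; exact: is_derive_cst.
under [X in is_derive _ _ X]eq_fun do rewrite big_cons.
by rewrite big_cons; case: (P i) => //; exact: is_deriveD.
Qed.

Lemma is_derive_inv (f : V -> R) x v (df : R) : f x != 0 ->
  is_derive x v f df -> is_derive x v (fun y => (f y)^-1) (- (df / f x ^+ 2)).
Proof.
move=> fx0 [fxv <-]; apply: DeriveDef; first exact: derivableV.
by rewrite deriveV// scaleNr mulrC.
Qed.

Lemma is_derive_mul (f g : V -> R) x v (df dg : R) :
  is_derive x v f df -> is_derive x v g dg ->
  is_derive x v (fun y => f y * g y) (df * g x + f x * dg).
Proof.
move=> hf hg; have h : is_derive x v (fun y => f y * g y) _ := is_deriveM hf hg.
by apply: (is_derive_eq h); rewrite /GRing.scale/= addrC [g x * _]mulrC.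
Qed.

Lemma is_derive_scale (c : R) (f : V -> R) x v (df : R) :
  is_derive x v f df -> is_derive x v (fun y => c * f y) (c * df).
Proof. by move=> hf; have := is_deriveZ c hf. Qed.

(** Stated through the logarithmic derivative df / f, so that one formula covers exponents of both
    signs and adds up well over products. *)
Lemma is_derive_exprz (f : V -> R) x v (df : R) (z : int) : f x != 0 ->
  is_derive x v f df ->
  is_derive x v (fun y => f y ^ z) (z%:~R * (df / f x) * f x ^ z).
Proof.
move=> fx0 hf.
have hX n : is_derive x v (fun y => f y ^+ n) (n%:R * (df / f x) * f x ^+ n).
  have := is_deriveX n hf; rewrite exprfctE => /is_derive_eq; apply.
  rewrite /GRing.scale/=; case: n => [|n]; first by rewrite !mul0r.
  rewrite /= exprS; set c := n.+1%:R; set u := f x ^+ n.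
  by have -> : c * (df / f x) * (f x * u) = c * u * df by field.
case: z => n; first exact: hX.
have fn0 : f x ^+ n.+1 != 0 by rewrite expf_neq0.
apply: (is_derive_eq (is_derive_inv fn0 (hX n.+1))).
have -> : f x ^ Negz n = (f x ^+ n.+1)^-1 by [].
have -> : (Negz n)%:~R = - n.+1%:R :> R by [].
by rewrite expr2 invfM [_ * (_ / _)]mulrA mulfK// !mulNr.
Qed.

End NormedModule.

Variable d : nat.
Implicit Types (x v : 'cV[R]_d) (s : lattice d).

Lemma is_derive_coord x v k : is_derive x v (fun y : 'cV[R]_d => y k 0) (v k 0).
Proof.
have dc : differentiable (fun y : 'cV[R]_d => y k 0) x.
  exact: differentiable_coord.
apply: DeriveDef; first exact: diff_derivable.
have := derive_mx (@derivable_id _ _ x v) => /matrixP/(_ k 0).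
by rewrite derive_id mxE.
Qed.

(** The predicate allows omitting a variable, as in the coefficients A_i and C_i. *)
Definition monomial (P : pred 'I_d) s x : R := \prod_(k < d | P k) x k 0 ^ s k.

Lemma is_derive_monomial (P : pred 'I_d) s x i : (forall k, x k 0 != 0) ->
  is_derive x (basis_vec R i) (monomial P s)
    ((P i)%:R * (s i)%:~R / x i 0 * monomial P s x).
Proof.
move=> x0.
(* Along any direction the logarithmic derivatives of the factors add up; along a basis vector only
   the i-th survives. *)
have H (r : seq 'I_d) : is_derive x (basis_vec R i)
    (fun y : 'cV_d => \prod_(k <- r | P k) y k 0 ^ s k)
    ((\sum_(k <- r | P k) (s k)%:~R * ((basis_vec R i) k 0 / x k 0)) *
     \prod_(k <- r | P k) x k 0 ^ s k).
  elim: r => [|k r IHr].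
    under [X in is_derive _ _ X]eq_fun do rewrite big_nil.
    by rewrite !big_nil mul0r; exact: is_derive_cst.
  under [X in is_derive _ _ X]eq_fun do rewrite big_cons.
  rewrite !big_cons; case: (P k) => //.
  apply: is_derive_eq.
    exact: is_derive_mul (is_derive_exprz _ (x0 k) (is_derive_coord x _ k)) IHr.
  by rewrite /=; ring.
apply: (is_derive_eq (H _)); congr (_ * _).
rewrite big_mkcond (bigD1 i)//= big1 ?addr0 => [|k ki].
  by rewrite mxE !eqxx mul1r; case: (P i); rewrite ?mul1r ?mul0r.
by rewrite mxE (negbTE ki) mul0r mulr0 if_same.
Qed.

End Calculus.

(** * Chain rule for rational maps *)

Section ChainRule.
Variables (R : realType) (d : nat).
Implicit Types (x y : 'cV[R]_d) (f : ratfun R d) (g h : ratmap R d).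

Let coords y : 'I_d -> R := fun j => y j 0.

Lemma differentiable_mmap (p : mpoly d R) x :
  differentiable (fun y : 'cV[R]_d => mmap idfun (coords y) p : R) x.
Proof.
apply: differentiable_big_sum => m; apply: differentiableM.
  exact: differentiable_cst.
apply: differentiable_big_prod => i.
case: (m i) => [|n].
  by under eq_fun do rewrite expr0; exact: differentiable_cst.
by have := differentiableX n (differentiable_coord x i 0); rewrite exprfctE.
Qed.

(** By continuity the denominator stays nonzero around [x], so a single representative serves a
    whole neighborhood. *)
Lemma near_has_val f x : ratfun_regular idfun (coords x) f ->
  exists2 F : 'cV[R]_d -> R, differentiable F x &
    \forall y \near x, has_val idfun (coords y) f (F y).
Proof.
case=> p [q [fE q0]].
exists (fun y => mmap idfun (coords y) p / mmap idfun (coords y) q : R).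
  apply: differentiableM; first exact: differentiable_mmap.
  by apply: differentiableV => //; exact: differentiable_mmap.
have qc := differentiable_continuous (differentiable_mmap q x).
have near_q : \forall y \near x, mmap idfun (coords y) q != 0.
  exact: (cvgr_neq0 _ qc q0).
apply: filterS near_q => y y0.
by exists p, q.
Qed.

Lemma near_regular f x : ratfun_regular idfun (coords x) f ->
  \forall y \near x, ratfun_regular idfun (coords y) f.
Proof.
move=> /near_has_val[F _ near_F]; apply: filterS near_F => y.
exact: has_val_regular.
Qed.

Lemma near_eq_differentiable (V W : normedModType R) (F G : V -> W) (a : V) :
  (\forall y \near a, F y = G y) -> differentiable F a -> differentiable G a.
Proof.
(* The first-order expansion of [F] at [a] is also one of [G]; uniqueness identifies the
   differential. *)
move=> FG dF; have Gexp : G \o shift a = cst (G a) + 'd F a +o_ 0 id.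
  apply/eqaddoP => eps e0; have /eqaddoP/(_ _ e0) := diff_locally dF.
  have FG0 : \forall y \near 0, F (y + a) = G (y + a).
    by have := FG; rewrite (near_shift 0) /= subr0.
  by apply: filterS2 FG0 => y Fy; rewrite !fctE/= -Fy (nbhs_singleton FG).
have dFc := diff_continuous dF.
by apply/diff_locallyP; rewrite (diff_unique dFc Gexp).
Qed.

Lemma differentiable_ratfun_eval f x : ratfun_regular idfun (coords x) f ->
  differentiable (ratfun_eval f : 'cV[R]_d -> R) x.
Proof.
move=> /near_has_val[F dF near_F]; apply: near_eq_differentiable dF.
by apply: filterS near_F => y /has_val_ratval.
Qed.

Lemma ratmap_evalE g x :
  ratmap_eval g x = \sum_i ratfun_eval (g i) x *: basis_vec R i.
Proof.
apply/colP => k; rewrite mxE summxE (bigD1 k)//= big1 => [|i ik].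
  by rewrite !mxE !eqxx mulr1 addr0.
by rewrite !mxE eq_sym (negbTE ik) mulr0.
Qed.

Lemma differentiable_ratmap_eval g x : regular_at g x ->
  differentiable (ratmap_eval g : 'cV[R]_d -> 'cV[R]_d) x.
Proof.
move=> gx.
have -> : (ratmap_eval g : 'cV[R]_d -> 'cV[R]_d) =
    \sum_i (fun y => ratfun_eval (g i) y *: basis_vec R i).
  by apply/funext => y; rewrite ratmap_evalE fct_sumE.
apply: differentiable_sum => i; apply: differentiableZl.
exact: differentiable_ratfun_eval.
Qed.

(** Links substitution of rational functions with composition of the real functions they define. *)
Lemma has_val_comp g h x f : regular_at h x ->
  ratfun_regular idfun (coords (ratmap_eval h x)) f ->
  has_val idfun (coords x) (ratval (@ratconst R d) h f)
    (ratfun_eval f (ratmap_eval h x)).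
Proof.
move=> hx fhx; apply: has_val_subst (regular_has_val fhx) => i.
by rewrite /coords mxE; exact: regular_has_val.
Qed.

Lemma regular_at_comp g h x :
  regular_at h x -> regular_at g (ratmap_eval h x) ->
  regular_at (ratmap_comp g h) x.
Proof.
move=> hx ghx i; rewrite ratmap_compE.
exact: has_val_regular (has_val_comp g hx (ghx i)).
Qed.

Lemma ratmap_eval_comp g h x :
  regular_at h x -> regular_at g (ratmap_eval h x) ->
  ratmap_eval (ratmap_comp g h) x = ratmap_eval g (ratmap_eval h x).
Proof.
move=> hx ghx; apply/colP => i; rewrite !mxE ratmap_compE.
exact: has_val_ratval (has_val_comp g hx (ghx i)).
Qed.

Lemma Jac_comp g h x : regular_at h x -> regular_at g (ratmap_eval h x) ->
  Jac x (ratmap_comp g h) = Jac (ratmap_eval h x) g *m Jac x h.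
Proof.
move=> hx ghx; apply/matrixP => i j; rewrite !mxE.
have dh := differentiable_ratmap_eval hx.
have dg := differentiable_ratfun_eval (ghx i).
rewrite /partial.
(* Derivatives need agreement on a neighborhood: regularity is an open condition, and
   [ratmap_eval h] is continuous at [x]. *)
transitivity ('D_(basis_vec R j) (ratfun_eval (g i) \o ratmap_eval h) x).
  apply: near_eq_derive.
  have near_h : \forall y \near x, regular_at h y.
    exact: filter_forall (fun k => near_regular (hx k)).
  have near_g : \forall y \near x,
      ratfun_regular idfun (coords (ratmap_eval h y)) (g i).
    exact: (differentiable_continuous dh (near_regular (ghx i))).
  apply: filterS2 near_h near_g => y hy gy.
  by rewrite ratmap_compE; exact: has_val_ratval (has_val_comp g hy gy).
rewrite deriveE; last exact: differentiable_comp.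
rewrite diff_comp//=.
(* Expanding the derivative of h on the basis produces the sum over k of the matrix product. *)
have -> : 'd (ratmap_eval h) x (basis_vec R j) =
    \sum_k 'D_(basis_vec R j) (ratfun_eval (h k)) x *: basis_vec R k.
  rewrite -deriveE// derive_mx; last exact: diff_derivable.
  apply/colP => k; rewrite mxE summxE (bigD1 k)//= big1 => [|l lk].
    rewrite !mxE !eqxx mulr1 addr0; congr ('D_ _ _ _).
    by apply/funext => y; rewrite mxE.
  by rewrite !mxE eq_sym (negbTE lk) mulr0.
rewrite linear_sum; apply: eq_bigr => k _.
by rewrite linearZ /= !mxE /partial (deriveE _ dg) mulrC.
Qed.

End ChainRule.

(** * The Hessian at the critical point *)

Section Hessian.
Variables (R : realType) (d : nat) (S : {fset lattice d}) (w : lattice d -> R).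
Implicit Types (x y h : 'cV[R]_d) (s : lattice d).

Let term x s : R := w s * monomial predT s x.

Lemma near_neq0 x : (forall k, x k 0 != 0) ->
  \forall y \near x, forall k, (y : 'cV[R]_d) k 0 != 0.
Proof.
move=> x0; have H k : \forall y \near x, (y : 'cV[R]_d) k 0 != 0.
  have kc := differentiable_continuous (differentiable_coord x k 0).
  exact: (cvgr_neq0 _ kc (x0 k)).
exact: filter_forall H.
Qed.

Lemma is_derive_chi x j : (forall k, x k 0 != 0) ->
  is_derive x (basis_vec R j) (chi S w)
    (\sum_(s <- S) (s j)%:~R * ((x j 0)^-1 * term x s)).
Proof.
move=> x0; have H s := is_derive_scale (w s) (is_derive_monomial predT s j x0).
apply: (is_derive_eq (is_derive_big_sum S predT H)).
by apply: eq_bigr => s _; rewrite /term mul1r; ring.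
Qed.

Lemma partial_chi x j : (forall k, x k 0 != 0) ->
  partial j (chi S w) x = (x j 0)^-1 * \sum_(s <- S) (s j)%:~R * term x s.
Proof.
move=> x0; rewrite /partial (@derive_val _ _ _ _ _ _ _ (is_derive_chi j x0)).
by rewrite mulr_sumr; apply: eq_bigr => s _; rewrite mulrCA.
Qed.

Lemma hessE x : critical_point S w x -> forall i j,
  hess S w x i j =
    (x i 0)^-1 * (x j 0)^-1 * \sum_(s <- S) (s i)%:~R * (s j)%:~R * term x s.
Proof.
move=> [x_gt0 crit] i j; have x0 k : x k 0 != 0 by rewrite gt_eqF.
(* This sum multiplies the derivative of the factor 1 / x_j, so the extra term that would appear for
   i = j vanishes. *)
have crit_j : \sum_(s <- S) (s j)%:~R * term x s = 0.
  have /eqP := crit j.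
  by rewrite partial_chi// mulf_eq0 invr_eq0 (negbTE (x0 j)) => /eqP.
have near_partial : \forall y \near x,
    \sum_(s <- S) (s j)%:~R * (((y : 'cV[R]_d) j 0)^-1 * term y s) =
    partial j (chi S w) y.
  apply: filterS (near_neq0 x0) => y y0.
  by rewrite /partial (@derive_val _ _ _ _ _ _ _ (is_derive_chi j y0)).
have H s := is_derive_scale (s j)%:~R
  (is_derive_mul (is_derive_inv (x0 j) (is_derive_coord x (basis_vec R i) j))
    (is_derive_scale (w s) (is_derive_monomial predT s i x0))).
have D := near_eq_is_derive near_partial (is_derive_big_sum S predT H).
rewrite /hess [LHS](@derive_val _ _ _ _ _ _ _ D).
rewrite (eq_bigr (fun s =>
  - (basis_vec R i j 0 / x j 0 ^+ 2) * ((s j)%:~R * term x s)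
  + (x i 0)^-1 * (x j 0)^-1 * ((s i)%:~R * (s j)%:~R * term x s))).
  by rewrite big_split /= -!mulr_sumr crit_j mulr0 add0r.
by move=> s _; rewrite /term /= mul1r; ring.
Qed.

(** The logarithmic derivative of the monomial x^s in the direction [h]. *)
Definition log_form x s h : R := \sum_i (s i)%:~R * (h i 0 / x i 0).

Lemma hess_formE x h h' : critical_point S w x ->
  hess_form S w x h h' =
    \sum_(s <- S) term x s * (log_form x s h * log_form x s h').
Proof.
move=> crit; rewrite /hess_form.
under eq_bigr => i _.
  under eq_bigr => j _ do rewrite hessE// mulr_sumr !mulr_suml.
  rewrite exchange_big; over.
rewrite exchange_big; apply: eq_bigr => s _.
rewrite /log_form big_distrlr /= mulr_sumr; apply: eq_bigr => i _.
by rewrite mulr_sumr; apply: eq_bigr => j _; ring.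
Qed.

(** The linear function L with coefficients c vanishes on the steps, hence is constant along walks;
    a walk from 0 to the i-th unit vector gives c_i = 0. *)
Lemma irreducible_spans (c : 'I_d -> R) : irreducible S ->
  (forall s, s \in S -> \sum_i (s i)%:~R * c i = 0) -> forall i, c i = 0.
Proof.
move=> irr c0 i.
pose L (s : lattice d) := \sum_i (s i)%:~R * c i.
have LB P Q : L (Q - P) = L Q - L P.
  by rewrite /L -sumrB; apply: eq_bigr => k _; rewrite !ffunE rmorphB mulrBl.
have Lpath P p : path (walk_edge S) P p -> L (last P p) = L P.
  elim: p P => //= Q p IHp P /andP[/andP[QP _] /IHp ->].
  by apply/eqP; rewrite -subr_eq0 -LB /L c0.
pose Q : lattice d := [ffun k => (k == i)%:Z].
have O0 : orthant (0 : lattice d) by apply/forallP => k; rewrite ffunE.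
have OQ : orthant Q by apply/forallP => k; rewrite ffunE.
have [p [_ /Lpath + pQ]] := irr _ _ O0 OQ; rewrite pQ /L.
rewrite [RHS]big1 => [|k _]; last by rewrite ffunE mul0r.
rewrite (bigD1 i)//= big1 ?addr0 => [|k ki]; last by rewrite ffunE (negbTE ki) mul0r.
by rewrite ffunE eqxx mul1r.
Qed.

Hypotheses (wS : weighting S w) (irrS : irreducible S).
Variables (x0 : 'cV[R]_d) (crit : critical_point S w x0).

Lemma hess_scalar_product : scalar_product (hess_form S w x0).
Proof.
split=> [h h'|a h h' h2|h hn0].
- by rewrite !hess_formE//; apply: eq_bigr => s _; rewrite [X in _ * X]mulrC.
- rewrite !hess_formE// mulr_sumr -big_split; apply: eq_bigr => s _ /=.
  have -> : log_form x0 s (a *: h + h') = a * log_form x0 s h + log_form x0 s h'.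
    rewrite /log_form mulr_sumr -big_split; apply: eq_bigr => i _ /=.
    by rewrite !mxE; ring.
  by ring.
- have x_gt0 := crit.1.
  have term_gt0 s : s \in S -> 0 < term x0 s.
    move=> /wS.1 ws; apply: mulr_gt0 => //; apply: prodr_gt0 => k _.
    exact: exprz_gt0.
  have F0 s : s \in S -> 0 <= term x0 s * (log_form x0 s h * log_form x0 s h).
    by move=> /term_gt0/ltW ?; apply: mulr_ge0 => //; rewrite -expr2 sqr_ge0.
  rewrite hess_formE// lt_neqAle big_seq sumr_ge0// andbT eq_sym.
  (* If [h, h] = 0, every square in the sum vanishes, so the vector of the h_i / x_i is orthogonal
     to all steps. *)
  apply: contra_neq hn0; move/eqP; rewrite psumr_eq0// => /allP sum0.
  apply/colP => i; rewrite mxE.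
  suff /eqP : h i 0 / x0 i 0 = 0.
    by rewrite mulf_eq0 invr_eq0 (gt_eqF (x_gt0 i)) orbF => /eqP.
  apply: (irreducible_spans (c := fun i => h i 0 / x0 i 0)) => // s sS.
  have := sum0 s sS; rewrite sS /= mulf_eq0 (gt_eqF (term_gt0 s sS)) /=.
  by rewrite mulf_eq0 orbb => /eqP.
Qed.

End Hessian.

(** * The generators of the group *)

Section Generators.
Variables (R : realType) (d : nat) (S : {fset lattice d}) (w : lattice d -> R).
Implicit Types (x y h : 'cV[R]_d) (s : lattice d) (i j : 'I_d) (e : int).

Let term x s : R := w s * monomial predT s x.

(** The i-th coordinate of [a] is unconstrained since the coefficient does not involve x_i. The
    field is arbitrary in order to cover both real points and substitution of phi_i. *)
Lemma has_val_inventory_coef (F : fieldType) (iota : {rmorphism R -> F})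
    (a : 'I_d -> F) i e : (forall j, j != i -> a j != 0) ->
  has_val iota a (inventory_coef S w i e)
    (\sum_(s <- S | s i == e) iota (w s) * \prod_(j < d | j != i) a j ^ s j).
Proof.
move=> a0; apply: has_val_sum => s _; apply: has_valM; first exact: has_val_const.
by apply: has_val_prod => j ji; apply: has_valXz; [exact: a0 | exact: has_val_var].
Qed.

Definition coef_at i e x : R :=
  \sum_(s <- S | s i == e) w s * monomial (fun j => j != i) s x.

Lemma has_val_coef_at x i e : (forall k, x k 0 != 0) ->
  has_val idfun (fun j => x j 0) (inventory_coef S w i e) (coef_at i e x).
Proof. by move=> x0; apply: (@has_val_inventory_coef R idfun). Qed.

(** Restores the factor x_i^e. The free factor [c] lets the identity serve for the coefficients and
    for their partial derivatives. *)
Lemma exprz_coef_sum x i e (c : lattice d -> R) : x i 0 != 0 ->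
  x i 0 ^ e * \sum_(s <- S | s i == e) c s * (w s * monomial (fun j => j != i) s x)
  = \sum_(s <- S | s i == e) c s * term x s.
Proof.
move=> xi0; rewrite mulr_sumr; apply: eq_bigr => s /eqP <-.
by rewrite /term /monomial [in RHS](bigD1 i)//=; ring.
Qed.

Lemma small_step_sum i (t : lattice d -> R) : small_steps S ->
  \sum_(s <- S) (s i)%:~R * t s =
  \sum_(s <- S | s i == 1) t s - \sum_(s <- S | s i == -1) t s.
Proof.
move=> smallS; rewrite [X in X - _]big_mkcond [X in _ - X]big_mkcond -sumrB.
rewrite !big_seq; apply: eq_bigr => s sS.
have := smallS s sS i; rewrite !inE => /or3P[] /eqP -> /=.
- by rewrite mulN1r sub0r.
- by rewrite mul0r subr0.
- by rewrite mul1r subr0.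
Qed.

Lemma is_derive_coef_at x i j e : (forall k, x k 0 != 0) ->
  is_derive x (basis_vec R j) (coef_at i e)
    (\sum_(s <- S | s i == e) ((j != i)%:R * (s j)%:~R / x j 0) *
       (w s * monomial (fun k => k != i) s x)).
Proof.
move=> x0.
have H s := is_derive_scale (w s) (is_derive_monomial (fun k => k != i) s j x0).
apply: (is_derive_eq (is_derive_big_sum S (fun s => s i == e) H)).
by apply: eq_bigr => s _; rewrite [RHS]mulrCA.
Qed.

Hypotheses (smallS : small_steps S) (wS : weighting S w) (irrS : irreducible S).
Variables (x0 : 'cV[R]_d) (crit : critical_point S w x0).

Local Notation form := (hess_form S w x0).
Local Notation e := (basis_vec R).

Lemma crit_neq0 k : x0 k 0 != 0.
Proof. by rewrite gt_eqF// crit.1. Qed.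
Hint Resolve crit_neq0 : core.

Lemma hess_sym i j : hess S w x0 i j = hess S w x0 j i.
Proof.
rewrite !hessE// [(x0 i 0)^-1 * _]mulrC; congr (_ * _).
by apply: eq_bigr => s _; rewrite [(s i)%:~R * _]mulrC.
Qed.

Lemma hess_form_basisr h i : form h (e i) = \sum_j hess S w x0 i j * h j 0.
Proof.
rewrite /hess_form; apply: eq_bigr => j _.
rewrite (bigD1 i)//= big1 => [|k ki]; last by rewrite mxE (negbTE ki) mulr0.
by rewrite mxE !eqxx mulr1 addr0 hess_sym.
Qed.

Lemma hess_form_basis i j : form (e i) (e j) = hess S w x0 i j.
Proof.
rewrite hess_form_basisr (bigD1 i)//= big1 => [|k ki].
  by rewrite mxE !eqxx mulr1 addr0 hess_sym.
by rewrite mxE (negbTE ki) mulr0.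
Qed.

Lemma basis_neq0 i : e i != 0.
Proof.
apply/eqP => /colP/(_ i); rewrite !mxE !eqxx => /eqP.
by rewrite oner_eq0.
Qed.

Lemma hess_gt0 i : 0 < hess S w x0 i i.
Proof.
have [_ _ pos] := hess_scalar_product wS irrS crit.
by rewrite -hess_form_basis; apply: pos; exact: basis_neq0.
Qed.

Lemma coef_atM i (n : int) :
  x0 i 0 ^ n * coef_at i n x0 = \sum_(s <- S | s i == n) term x0 s.
Proof.
have := exprz_coef_sum n (fun=> 1) (crit_neq0 i).
under eq_bigr do rewrite mul1r.
by under [RHS]eq_bigr do rewrite mul1r.
Qed.

(** Criticality in the direction i reads x_i A_i - C_i / x_i = 0. *)
Lemma coef_atN1 i : coef_at i (-1) x0 = x0 i 0 ^+ 2 * coef_at i 1 x0.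
Proof.
have := crit.2 i; rewrite partial_chi//.
move/eqP; rewrite mulf_eq0 invr_eq0 (negbTE (crit_neq0 i)) /= => /eqP.
rewrite small_step_sum// -!coef_atM expr1z exprN1 => /eqP.
rewrite subr_eq0 => /eqP E.
by rewrite expr2 -mulrA E mulrA mulfV ?mul1r.
Qed.

(** Since s_i^2 is 1 on the steps with s_i = 1 or -1, x_i^2 H_ii = x_i A_i + C_i / x_i, which is 2
    x_i A_i by criticality. *)
Lemma coef_at1 i : coef_at i 1 x0 = x0 i 0 * hess S w x0 i i / 2.
Proof.
rewrite hessE// (eq_bigr _ (fun s _ => esym (mulrA _ _ _))) small_step_sum//.
rewrite [X in X - _](eq_bigr (fun s => term x0 s)) => [|s /eqP ->]; last first.
  by rewrite mul1r.
rewrite [X in _ - X](eq_bigr (fun s => - term x0 s)) => [|s /eqP ->]; last first.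
  by rewrite mulN1r.
rewrite sumrN opprK -!coef_atM expr1z exprN1 coef_atN1.
by field; exact: crit_neq0.
Qed.

Lemma coef_at1_neq0 i : coef_at i 1 x0 != 0.
Proof.
rewrite coef_at1 !mulf_neq0 ?invr_eq0 ?pnatr_eq0//.
by rewrite gt_eqF// hess_gt0.
Qed.

Lemma coef_atN1_neq0 i : coef_at i (-1) x0 != 0.
Proof. by rewrite coef_atN1 mulf_neq0 ?expf_neq0// coef_at1_neq0. Qed.

Lemma inventory_coef_neq0 i (n : int) :
  coef_at i n x0 != 0 -> inventory_coef S w i n != 0.
Proof.
by move=> n0; apply: has_val_neq0 n0 (has_val_coef_at i n crit_neq0).
Qed.

Definition phi_at i y : R := (y i 0)^-1 * (coef_at i (-1) y / coef_at i 1 y).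

Lemma has_val_phi_ratio y i : (forall k, y k 0 != 0) -> coef_at i 1 y != 0 ->
  has_val idfun (fun j => y j 0) (phi S w i i) (phi_at i y).
Proof.
move=> y0 A0; rewrite ffunE eqxx; apply: has_valM.
  by apply: has_valV (y0 i) _; exact: has_val_var.
apply: has_valM; first exact: has_val_coef_at.
by apply: has_valV A0 _; exact: has_val_coef_at.
Qed.

Lemma has_val_phi_var (F : fieldType) (iota : {rmorphism R -> F})
    (a : 'I_d -> F) i k : k != i -> has_val iota a (phi S w i k) (a k).
Proof. by move=> ki; rewrite ffunE (negbTE ki); exact: has_val_var. Qed.

Lemma phi_at_crit i : phi_at i x0 = x0 i 0.
Proof.
rewrite /phi_at coef_atN1; move: (coef_at1_neq0 i) (crit_neq0 i) => A0 xi0.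
by field; rewrite xi0 A0.
Qed.

Lemma has_val_phi_crit i k :
  has_val idfun (fun j => x0 j 0) (phi S w i k) (x0 k 0).
Proof.
have [->|ki] := eqVneq k i; last exact: (@has_val_phi_var R idfun).
rewrite -(phi_at_crit i); apply: has_val_phi_ratio => //; exact: coef_at1_neq0.
Qed.

(** A_i and C_i are unchanged by the substitution, so the i-th component becomes the inverse of
    x_i^-1 C_i / A_i, times C_i / A_i, that is x_i. *)
Lemma phi_involutive i : ratmap_comp (phi S w i) (phi S w i) = ratmap_id R d.
Proof.
apply/ffunP => k; rewrite ratmap_compE [RHS]ffunE; apply: has_val_ratval.
have [->|ki] := eqVneq k i; last first.
  have := has_val_phi_var (@ratconst R d) (phi S w i) ki.
  by rewrite [X in has_val _ _ _ X -> _]ffunE (negbTE ki).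
set A := inventory_coef S w i 1; set C := inventory_coef S w i (-1).
have A0 : A != 0 by apply: inventory_coef_neq0; exact: coef_at1_neq0.
have C0 : C != 0 by apply: inventory_coef_neq0; exact: coef_atN1_neq0.
have x_neq0 : ratvar R i != 0 := ratvar_neq0 R i.
have phiiE : phi S w i i = (ratvar R i)^-1 * (C / A) by rewrite ffunE eqxx.
have phij j : j != i -> phi S w i j = ratvar R j.
  by move=> ji; rewrite ffunE (negbTE ji).
have coefv n : has_val (@ratconst R d) (phi S w i)
    (inventory_coef S w i n) (inventory_coef S w i n).
  have E : inventory_coef S w i n = \sum_(s <- S | s i == n)
      ratconst d (w s) * \prod_(j < d | j != i) phi S w i j ^ s j.
    by apply: eq_bigr => s _; congr (_ * _); apply: eq_bigr => j /phij ->.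
  rewrite {2}E; apply: has_val_inventory_coef => j /phij ->.
  exact: ratvar_neq0.
have CA0 : C / A != 0 := mulf_neq0 C0 (invr_neq0 A0).
have phii0 : phi S w i i != 0.
  by rewrite phiiE; exact: mulf_neq0 (invr_neq0 x_neq0) CA0.
(* The expected value takes the shape of the formula for phi_i with phi_i substituted, so that the
   closure rules for values apply. *)
have -> : ratvar R i = (phi S w i i)^-1 * (C / A).
  by rewrite phiiE invfM invrK -mulrA (mulVf CA0) mulr1.
rewrite {1}phiiE; apply: has_valM.
  by apply: has_valV phii0 _; exact: has_val_var.
by apply: has_valM (coefv _) _; apply: has_valV A0 (coefv _).
Qed.

Lemma Jac_phi i k j : Jac x0 (phi S w i) k j =
  (k == j)%:R - (k == i)%:R * (2 * hess S w x0 i j / hess S w x0 i i).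
Proof.
rewrite mxE /partial; have [->|ki] := eqVneq k i; last first.
  have near_var : \forall y \near x0,
      (y : 'cV[R]_d) k 0 = ratfun_eval (phi S w i k) y.
    have H (y : 'cV[R]_d) : y k 0 = ratfun_eval (phi S w i k) y.
      symmetry; apply: has_val_ratval.
      exact: (@has_val_phi_var R idfun (fun j => y j 0)).
    exact: filterE H.
  have D := near_eq_is_derive near_var (is_derive_coord x0 (e j) k).
  by rewrite [LHS](@derive_val _ _ _ _ _ _ _ D) mxE eqxx andbT mul0r subr0.
have DA := is_derive_coef_at i j 1 crit_neq0.
have DC := is_derive_coef_at i j (-1) crit_neq0.
set dA := (X in is_derive _ _ _ X) in DA.
set dC := (X in is_derive _ _ _ X) in DC.
have A0 := coef_at1_neq0 i; have xi0 := crit_neq0 i.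
(* The formula [phi_at] agrees with the rational function where A_i and all coordinates are nonzero,
   which holds around [x0]. *)
have near_phi : \forall y \near x0,
    phi_at i y = ratfun_eval (phi S w i i) y.
  have near_A : \forall y \near x0, coef_at i 1 y != 0.
    have A_x0 := has_val_coef_at i 1 crit_neq0.
    have [F dF FA] := near_has_val (has_val_regular A_x0).
    have F0 : F x0 != 0.
      by rewrite (has_val_inj (nbhs_singleton FA) A_x0).
    have near_F : \forall y \near x0, F y != 0.
      exact: (cvgr_neq0 _ (differentiable_continuous dF) F0).
    apply: filterS3 near_F FA (near_neq0 crit_neq0) => y Fy0 FAy y0.
    by rewrite (has_val_inj (has_val_coef_at i 1 y0) FAy).
  apply: filterS2 near_A (near_neq0 crit_neq0) => y Ay y0.
  by symmetry; apply: has_val_ratval; exact: has_val_phi_ratio.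
have D := near_eq_is_derive near_phi
  (is_derive_mul (is_derive_inv xi0 (is_derive_coord x0 (e j) i))
                 (is_derive_mul DC (is_derive_inv A0 DA))).
rewrite [LHS](@derive_val _ _ _ _ _ _ _ D) {D}.
(* Up to the indicator, both sides are the sum of s_i s_j w(s) x^s / x_j. This single relation
   eliminates dC, after which dA cancels. *)
have dAC : x0 i 0 * dA - (x0 i 0)^-1 * dC = (j != i)%:R * (x0 i 0 * hess S w x0 i j).
  have := exprz_coef_sum 1 (fun s => (j != i)%:R * (s j)%:~R / x0 j 0) xi0.
  have := exprz_coef_sum (-1) (fun s => (j != i)%:R * (s j)%:~R / x0 j 0) xi0.
  rewrite expr1z exprN1 -/dA -/dC => -> ->.
  rewrite -small_step_sum// hessE// !mulr_sumr; apply: eq_bigr => s _.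
  move: (crit_neq0 j) => xj0; rewrite /term.
  move: (_%:R) (monomial _ _ _) => b m.
  by field; rewrite xi0 xj0.
have -> : dC = x0 i 0 * (x0 i 0 * dA - (j != i)%:R * (x0 i 0 * hess S w x0 i j)).
  by rewrite -dAC opprB addrC subrK mulrA mulfV// mul1r.
rewrite mxE eqxx andbT coef_atN1 coef_at1 [i == j]eq_sym mul1r.
have h0 : hess S w x0 i i != 0 by rewrite gt_eqF// hess_gt0.
(* Here a = dA, b = H_ii, t = H_ij and u = x_i, while c and c' are the indicators of i = j and its
   negation. *)
have field_id (a b c c' r t u : R) : b != 0 -> u != 0 ->
    r = - c - c' * (2 * t / b) -> - (c / u ^+ 2) *
    (u ^+ 2 * (u * b / 2) / (u * b / 2)) +
  u^-1 * (u * (u * a - c' * (u * t)) / (u * b / 2) +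
    u ^+ 2 * (u * b / 2) * - (a / (u * b / 2) ^+ 2)) = r.
  by move=> b0 u0 ->; field; rewrite b0 u0.
case: eqVneq => [->|_] /=; apply: (field_id _ _ _ _ _ _ _ h0 xi0).
  by rewrite mul0r subr0 -mulrA (mulfV h0) mulr1 mulr2n opprD addrA subrr add0r.
by rewrite mul1r oppr0.
Qed.

End Generators.

(** * Invariance of the form *)

Section ScalarProduct.
Variables (R : realType) (d : nat).
Implicit Types (b : 'cV[R]_d -> 'cV[R]_d -> R) (e h k : 'cV[R]_d).

Lemma scalar_product00 b : scalar_product b -> b 0 0 = 0.
Proof.
move=> [_ lin _]; have := lin (-1) 0 0 0.
by rewrite scaler0 addr0 mulN1r addNr.
Qed.

Lemma reflection_isometry b e h k : scalar_product b -> e != 0 ->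
  b (h - (2 * b h e / b e e) *: e) (k - (2 * b k e / b e e) *: e) = b h k.
Proof.
move=> [sym lin pos] e0; have bee0 : b e e != 0 by rewrite gt_eqF// pos.
have lin' u v a x : b (u - a *: v) x = b u x - a * b v x.
  by rewrite addrC -scaleNr lin mulNr addrC.
have linr u v a x : b x (u - a *: v) = b x u - a * b x v.
  by rewrite sym lin' !(sym x).
by rewrite lin' !linr (sym e k); field.
Qed.

(** If M h = 0 then b(h, h) = b'(0, 0) = 0, so h = 0 by definiteness. *)
Lemma isometry_unitmx b b' (M : 'M[R]_d) : scalar_product b -> b' 0 0 = 0 ->
  (forall h, b' (M *m h) (M *m h) = b h h) -> M \in unitmx.
Proof.
(* [kermx] consists of row vectors, hence the transposes. *)
move=> [_ _ pos] b'0 iso; rewrite -unitmx_tr -row_free_unit -kermx_eq0.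
apply/rowV0P => v /sub_kermxP vM0; apply: trmx_inj; rewrite trmx0.
apply: contraTeq isT => /pos.
by rewrite -iso -[M]trmxK -trmx_mul vM0 trmx0 b'0 ltxx.
Qed.

Lemma dotE h k : dot h k = (h^T *m k) 0 0.
Proof. by rewrite mxE; apply: eq_bigr => i _; rewrite mxE. Qed.

End ScalarProduct.

(** * The action of the group at the critical point *)

Section Group.
Variables (R : realType) (d : nat) (S : {fset lattice d}) (w : lattice d -> R).
Hypotheses (smallS : small_steps S) (wS : weighting S w) (irrS : irreducible S).
Variables (x0 : 'cV[R]_d) (crit : critical_point S w x0).
Implicit Types (g : ratmap R d) (h : 'cV[R]_d).

Local Notation form := (hess_form S w x0).
Local Notation e := (basis_vec R).

Let form_sp : scalar_product form := hess_scalar_product wS irrS crit.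

Lemma Jac_phi_mul i h : Jac x0 (phi S w i) *m h =
  h - (2 * form h (e i) / form (e i) (e i)) *: e i.
Proof.
apply/colP => k; rewrite !mxE eqxx andbT (hess_form_basis crit).
rewrite (hess_form_basisr crit) mulr_sumr !mulr_suml.
rewrite [h k 0](_ : _ = \sum_j (k == j)%:R * h j 0); last first.
  rewrite (bigD1 k)//= big1 => [|j jk]; first by rewrite eqxx mul1r addr0.
  by rewrite eq_sym (negbTE jk) mul0r.
rewrite -sumrB; apply: eq_bigr => j _; rewrite (Jac_phi smallS wS irrS crit).
by ring.
Qed.

Lemma Jac_id : Jac x0 (ratmap_id R d) = 1%:M.
Proof.
apply/matrixP => i j; rewrite !mxE /partial.
have -> : ratfun_eval (ratmap_id R d i) = (fun y : 'cV[R]_d => y i 0).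
  apply/funext => y; apply: has_val_ratval; rewrite ffunE.
  exact: (@has_val_var R d R idfun (fun j => y j 0)).
rewrite (@derive_val _ _ _ _ _ _ _ (is_derive_coord x0 (e j) i)).
by rewrite mxE eqxx andbT.
Qed.

(** The induction invariant over G: regularity and fixing [x0] keep the chain rule at one base
    point. *)
Definition form_isometry g : Prop :=
  [/\ regular_at g x0, ratmap_eval g x0 = x0 &
      forall h h', form (Jac x0 g *m h) (Jac x0 g *m h') = form h h'].

Lemma has_val_fixed g :
  (forall k, has_val idfun (fun j => x0 j 0) (g k) (x0 k 0)) ->
  regular_at g x0 /\ ratmap_eval g x0 = x0.
Proof.
move=> gv; split=> [k|]; first exact: has_val_regular (gv k).
by apply/colP => k; rewrite mxE; exact: has_val_ratval (gv k).
Qed.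

Lemma form_isometry_phi i : form_isometry (phi S w i).
Proof.
have [? ?] := has_val_fixed (has_val_phi_crit smallS wS irrS crit i).
split=> // h h'; rewrite !Jac_phi_mul reflection_isometry//.
exact: basis_neq0.
Qed.

Lemma form_isometry_id : form_isometry (ratmap_id R d).
Proof.
have idv k : has_val idfun (fun j => x0 j 0) (ratmap_id R d k) (x0 k 0).
  by rewrite ffunE; exact: (@has_val_var R d R idfun (fun j => x0 j 0)).
have [? ?] := has_val_fixed idv.
by split=> // h h'; rewrite Jac_id !mul1mx.
Qed.

Lemma Jac_comp_fixed g1 g2 : form_isometry g1 -> form_isometry g2 ->
  Jac x0 (ratmap_comp g1 g2) = Jac x0 g1 *m Jac x0 g2.
Proof.
move=> [r1 _ _] [r2 fix2 _].
have r12 : regular_at g1 (ratmap_eval g2 x0) by rewrite fix2.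
by rewrite (Jac_comp r2 r12) fix2.
Qed.

Lemma form_isometry_comp g1 g2 : form_isometry g1 -> form_isometry g2 ->
  form_isometry (ratmap_comp g1 g2).
Proof.
move=> iso1 iso2; have [r1 fix1 i1] := iso1; have [r2 fix2 i2] := iso2.
have r12 : regular_at g1 (ratmap_eval g2 x0) by rewrite fix2.
split; first exact: regular_at_comp.
  by rewrite (ratmap_eval_comp r2 r12) fix2.
by move=> h h'; rewrite (Jac_comp_fixed iso1 iso2) -!mulmxA i1 i2.
Qed.

(* The inverse is carried along because regularity of g at x0 alone says
   nothing about its inverse. *)
Lemma combi_group_isometry g : combi_group S w g ->
  exists g', [/\ ratmap_inverse g g', form_isometry g & form_isometry g'].
Proof.
elim=> [i||g1 g2 _ [g1' [inv1 iso1 iso1']] _ [g2' [inv2 iso2 iso2']]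
       |g1 g2 _ [g1' [inv1 iso1 iso1']] inv12].
- exists (phi S w i); have iso := form_isometry_phi i.
  have inv := phi_involutive smallS wS irrS crit i.
  by split; first split.
- exists (ratmap_id R d); have iso := form_isometry_id.
  have inv := ratmap_comp_id (ratmap_id R d).
  by split; first split.
- exists (ratmap_comp g2' g1'); split; first exact: ratmap_inverse_comp.
    exact: form_isometry_comp.
  exact: form_isometry_comp.
(* The inverse adjoined to the group is the one already provided by induction. *)
- have <- := ratmap_inverse_uniq inv1 inv12.
  by exists g1; split; first exact: ratmap_inverse_sym.
Qed.

Lemma form_isometry_unitmx g : form_isometry g -> Jac x0 g \in unitmx.
Proof.
move=> [_ _ iso]; apply: (isometry_unitmx form_sp (scalar_product00 form_sp)).
by move=> h; exact: iso.
Qed.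

(** * The isometry with the standard Euclidean space *)

Section CovarianceIsometry.
Variable B : 'M[R]_d.
Hypothesis sqrtB : spd_sqrt (cov_matrix S w x0) B.

Let sigma i : R := Num.sqrt (form (e i) (e i)).

Let sigma_gt0 i : 0 < sigma i.
Proof. by rewrite sqrtr_gt0 (hess_form_basis crit) hess_gt0. Qed.

Definition cov_isometry : 'M[R]_d := B *m diag_mx (\row_i sigma i).

(** With D the diagonal matrix of the [sigma i], the covariance matrix is D^-1 H D^-1, so the Gram
    matrix of B D is D B^2 D = H. *)
Lemma cov_isometryE h h' :
  dot (cov_isometry *m h) (cov_isometry *m h') = form h h'.
Proof.
have [[symB _] BB] := sqrtB.
rewrite dotE !trmx_mul symB tr_diag_mx -!mulmxA (mulmxA B) BB.
rewrite mxE; apply: eq_bigr => i _; rewrite mxE.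
rewrite mul_diag_mx !mxE !mulr_sumr; apply: eq_bigr => j _.
rewrite mul_diag_mx !mxE.
have hh k := ltW (hess_gt0 wS irrS crit k).
rewrite sqrtrM// -!(hess_form_basis crit) -/(sigma i) -/(sigma j).
have si := lt0r_neq0 (sigma_gt0 i); have sj := lt0r_neq0 (sigma_gt0 j).
by field; rewrite si sj.
Qed.

Lemma cov_isometry_unitmx : cov_isometry \in unitmx.
Proof.
apply: (isometry_unitmx form_sp (b' := @dot R d)) => [|h].
  by rewrite /dot big1// => i _; rewrite mxE mul0r.
exact: cov_isometryE.
Qed.

Lemma cov_isometry_basis i :
  cov_isometry *m ((sigma i)^-1 *: e i) = B *m e i.
Proof.
rewrite /cov_isometry -mulmxA; congr (_ *m _).
apply/colP => k; rewrite mul_diag_mx !mxE eqxx andbT.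
have := lt0r_neq0 (sigma_gt0 i).
by have [->|_] := eqVneq k i => ?; rewrite ?mulr0// mulr1 mulfV.
Qed.

(** Gives the uniqueness of Phi: the f_i form a basis. *)
Lemma linear_eq_scaled_basis (P Q : {linear 'cV[R]_d -> 'cV[R]_d}) :
  (forall i, P ((sigma i)^-1 *: e i) = Q ((sigma i)^-1 *: e i)) -> P =1 Q.
Proof.
move=> PQ h.
have -> : h = \sum_i (h i 0 * sigma i) *: ((sigma i)^-1 *: e i).
  apply/colP => k; rewrite summxE (bigD1 k)//= big1 => [|j jk].
    by rewrite !mxE !eqxx mulr1 mulfK ?addr0// lt0r_neq0.
  by rewrite !mxE eq_sym (negbTE jk) !mulr0.
rewrite !linear_sum; apply: eq_bigr => i _.
move: (PQ i); move: ((sigma i)^-1 *: e i) => f Pf.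
by rewrite !linearZ Pf.
Qed.

End CovarianceIsometry.

End Group.

Theorem theorem5 (R : realType) (d : nat) (S : {fset lattice d})
    (w : lattice d -> R) (x0 : 'cV[R]_d)
    (d_ge1 : (1 <= d)%N)
    (smallS : small_steps S)
    (wS : weighting S w)
    (irrS : irreducible S)
    (crit_x0 : critical_point S w x0) :
  let G := combi_group S w in
  let J := Jac x0 in
  let form := hess_form S w x0 in
  let e := @basis_vec R d in
  let f := fun i => (Num.sqrt (form (e i) (e i)))^-1 *: e i in
  [/\ (* (i) *)
      [/\ forall g, G g ->
            [/\ birational g, regular_at g x0, ratmap_eval g x0 = x0 &
                J g \in unitmx],
          J (ratmap_id R d) = 1%:M &
          forall g h, G g -> G h -> J (ratmap_comp g h) = J g *m J h],
      (* (ii) *)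
      scalar_product form,
      (* (iii) *)
      forall g, G g -> forall h k, form (J g *m h) (J g *m k) = form h k,
      (* (iv) *)
      forall Delta_sqrt : 'M[R]_d,
        spd_sqrt (cov_matrix S w x0) Delta_sqrt ->
        let u := fun i => Delta_sqrt *m e i in
        exists Phi : {linear 'cV[R]_d -> 'cV[R]_d},
          [/\ forall i, Phi (f i) = u i,
              forall Psi : {linear 'cV[R]_d -> 'cV[R]_d},
                (forall i, Psi (f i) = u i) -> Psi =1 Phi &
              isometry_between form (@dot R d) Phi] &
      (* (v) *)
      forall i, orthogonal_reflection form (e i) (mulmx (J (phi S w i)))].
Proof.
move=> G J form e f.
have form_sp := hess_scalar_product wS irrS crit_x0.
have group_iso g (Gg : G g) := combi_group_isometry smallS wS irrS crit_x0 Gg.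
split=> //.
- split=> [g /group_iso[g' [inv iso _]]||g h].
  + have [reg fixed _] := iso; split=> //; first by exists g'.
    exact: form_isometry_unitmx iso.
  + exact: Jac_id.
  + move=> /group_iso[_ [_ isog _]] /group_iso[_ [_ isoh _]].
    exact: Jac_comp_fixed isog isoh.
- by move=> g /group_iso[_ [_ [_ _ iso] _]].
- move=> B sqrtB u; pose M := cov_isometry S w x0 B.
  have MU : M \in unitmx := cov_isometry_unitmx wS irrS crit_x0 sqrtB.
  have Mf i : M *m f i = u i := cov_isometry_basis wS irrS crit_x0 B i.
  exists (mulmx M); split=> // [Psi Psif|].
    by apply: (linear_eq_scaled_basis wS irrS crit_x0) => i; rewrite Psif -Mf.
  split=> [|h k]; last exact: cov_isometryE.
  by exists (mulmx (invmx M)) => h /=; rewrite ?mulKmx ?mulKVmx.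
- move=> i; have [_ _ pos] := form_sp.
  have ei_neq0 : form (e i) (e i) != 0 by rewrite gt_eqF// pos// basis_neq0.
  (* The coefficient 2 [h, e_i] / [e_i, e_i] is 2 at h = e_i and 0 on the orthogonal complement. *)
  split=> [|h hi]; rewrite (Jac_phi_mul smallS wS irrS crit_x0).
    by rewrite mulfK// scaler_nat mulr2n opprD addrA subrr add0r.
  by rewrite -/form -/(e i) hi mulr0 mul0r scale0r subr0.
Qed.
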